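(* Let $p$ be a prime, $\mathbb{F}_q$ a finite field of characteristic $p$, $n\ge1$, and $s_1,\dots,s_n$ positive integers. Let $$\mathcal{R}=\frac{\mathbb{F}_q[x_1,\dots,x_n]}{\langle x_1^{p^{s_1}}-1,\dots,x_n^{p^{s_n}}-1\rangle},\qquad \mathcal{R}_{x_j}=\frac{\mathbb{F}_q[x_j]}{\langle x_j^{p^{s_j}}-1\rangle}\quad (1\le j\le n).$$ Let $i_1,\dots,i_n$ be integers with $0\le i_j\le p^{s_j}$, and let $C=\langle (x_1-1)^{i_1}\cdots(x_n-1)^{i_n}\rangle\subset\mathcal{R}$ and $C_{x_j}=\langle(x_j-1)^{i_j}\rangle\subset\mathcal{R}_{x_j}$. Then $$d_H(C)=\prod_{j=1}^{n}d_H(C_{x_j}).$$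
   Context: Each element of $\mathcal{R}$ is identified with its unique representative $f=\sum f_{(a_1,\dots,a_n)}x_1^{a_1}\cdots x_n^{a_n}$ with $0\le a_j<p^{s_j}$. Its Hamming weight $w_H(f)$ is the number of nonzero coefficients $f_{(a_1,\dots,a_n)}$, and for an ideal (code) $C$, $d_H(C)=\min\{w_H(f): f\in C\setminus\{0\}\}$. The analogous definitions are used in $\mathcal{R}_{x_j}$ (the case $n=1$). For the zero code the convention is $d_H(\{0\})=0$. *)

(* Defs.v *)
From HB Require Import structures.
From mathcomp Require Import all_boot all_order all_algebra.
From mathcomp Require Import generic_quotient ring_quotient.
From mathcomp Require Import boolp classical_sets.
From mathcomp Require Import ssrcomplements mpoly.

Set Implicit Arguments.
Unset Strict Implicit.
Unset Printing Implicit Defensive.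

Import GRing.Theory.
Local Open Scope ring_scope.
Local Open Scope quotient_scope.

Definition ideal_gen (A : comNzRingType) (I : finType) (g : I -> A) : set A :=
  fun x => exists a : I -> A, x = \sum_i a i * g i.

Definition principal_ideal (A : comNzRingType) (g : A) : set A :=
  fun x => exists a : A, x = a * g.

Section QuotientRing.
Variables (F : fieldType) (n : nat) (N : 'I_n -> nat).

Definition relator (j : 'I_n) : {mpoly F[n]} := 'X_j ^+ N j - 1.

Definition relation_ideal : {pred {mpoly F[n]}} :=
  fun f => `[< ideal_gen relator f >].

Lemma relation_ideal_closed : idealr_closed relation_ideal.
Proof.
split.
- by apply/asboolP; exists (fun=> 0); rewrite big1 // => j _; rewrite mul0r.
- apply/negP => /asboolP [a /(congr1 (meval (fun=> 1)))].
  rewrite meval1 raddf_sum /= big1 => [|j _]; first by apply/eqP/oner_neq0.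
  by rewrite mevalM mevalB rmorphXn /= mevalXU expr1n meval1 subrr mulr0.
- move=> c u v /asboolP [a ->] /asboolP [b ->]; apply/asboolP.
  exists (fun j => c * a j + b j); rewrite mulr_sumr -big_split /=.
  by apply: eq_bigr => j _; rewrite mulrDl mulrA.
Qed.

HB.instance Definition _ :=
  isIdealr.Build {mpoly F[n]} relation_ideal relation_ideal_closed.

(* F[x_1, ..., x_n] / <x_1^(N 1) - 1, ..., x_n^(N n) - 1> *)
Definition quot_ring : comNzRingType := {ideal_quot relation_ideal}.

Definition quot_class (f : {mpoly F[n]}) : quot_ring :=
  \pi_{ideal_quot relation_ideal} f.

Definition quot_var (j : 'I_n) : quot_ring := quot_class 'X_j.

Definition reduced (f : {mpoly F[n]}) : Prop :=
  forall m, m \in msupp f -> forall j, (m j < N j)%N.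

(* When all N j are positive, the reduced representative exists and is unique
   (representativeP, representative_unique), so the default is not used. *)
Definition representative (x : quot_ring) : {mpoly F[n]} :=
  xget 0 [set f | reduced f /\ quot_class f = x]%classic.

Definition hamming_weight (x : quot_ring) : nat :=
  size (msupp (representative x)).

(* The zero code has distance 0 by convention. *)
Definition hamming_distance (C : set quot_ring) : nat :=
  let weights w := `[< exists2 x, C x /\ x != 0 & hamming_weight x = w >] in
  if pselect (exists w, weights w) is left ex then ex_minn ex else 0%N.

Lemma quot_classP (f g : {mpoly F[n]}) :
  quot_class f = quot_class g <-> ideal_gen relator (f - g).
Proof.
have := Quotient.idealrBE relation_ideal f g; rewrite /quot_class => E.
split=> [/eqP|] H; first by move: H; rewrite -E => /asboolP.
by apply/eqP; rewrite -E; apply/asboolP.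
Qed.

Definition mnm_mod (m : 'X_{1..n}) : 'X_{1..n} := [multinom (m j %% N j)%N | j < n].

Definition mreduce (f : {mpoly F[n]}) : {mpoly F[n]} :=
  \sum_(m <- msupp f) f@_m *: 'X_[mnm_mod m].

Lemma mreduceE k (f : {mpoly F[n]}) : (msize f <= k)%N ->
  mreduce f = \sum_(m : 'X_{1..n < k}) f@_m *: 'X_[mnm_mod m].
Proof.
move=> le_fk; pose I : subFinType _ := 'X_{1..n < k}.
rewrite /mreduce (big_mksub I) ?msupp_uniq //=; last first.
  by move=> m /msize_mdeg_lt /leq_trans; apply.
by rewrite big_rmcond //= => m /memN_msupp_eq0 ->; rewrite scale0r.
Qed.

Lemma mreduce_linear : linear mreduce.
Proof.
move=> c f g; pose k := maxn (msize (c *: f + g)) (maxn (msize f) (msize g)).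
rewrite !(@mreduceE k) ?leq_max ?leqnn ?orbT //.
rewrite scaler_sumr -big_split /=; apply: eq_bigr => m _.
by rewrite mcoeffD mcoeffZ scalerDl scalerA.
Qed.

HB.instance Definition _ :=
  GRing.isLinear.Build F {mpoly F[n]} {mpoly F[n]} *:%R mreduce mreduce_linear.

Lemma mreduceX m : mreduce 'X_[m] = 'X_[mnm_mod m].
Proof. by rewrite /mreduce msuppX big_seq1 mcoeffX eqxx scale1r. Qed.

Lemma mreduce_ideal f : ideal_gen relator f -> mreduce f = 0.
Proof.
case=> a ->; rewrite raddf_sum /= big1 // => j _.
rewrite (mpolyE (a j)) mulr_suml raddf_sum /= big1 // => m _.
rewrite -scalerAl linearZ /= /relator mulrBr mulr1 raddfB /=.
rewrite mpolyXn -mpolyXD !mreduceX; apply/eqP; rewrite scaler_eq0 subr_eq0.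
apply/orP; right; apply/eqP; congr ('X_[_]); apply/mnmP => i.
rewrite !mnmE mulmnE mnm1E; case: eqP => [->|_]; last by rewrite addn0.
by rewrite mul1n modnDr.
Qed.

Lemma mreduce_id f : reduced f -> mreduce f = f.
Proof.
move=> rf; rewrite [RHS]mpolyE /mreduce big_seq [RHS]big_seq.
apply: eq_bigr => m /rf lt_m; congr (_ *: 'X_[_]).
by apply/mnmP => j; rewrite mnmE modn_small.
Qed.

Lemma mreduce_reduced f : (forall j, (0 < N j)%N) -> reduced (mreduce f).
Proof.
move=> N_gt0 m; rewrite mcoeff_msupp /mreduce raddf_sum /= => nz j.
case: (ltnP (m j) (N j)) => // le_Nm; case/eqP: nz.
rewrite big1 // => m' _; rewrite mcoeffZ mcoeffX.
case: eqP => [Em|]; last by rewrite mulr0.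
by move: le_Nm; rewrite -Em mnmE leqNgt ltn_pmod.
Qed.

Lemma quot_class_monom m : quot_class 'X_[mnm_mod m] = quot_class 'X_[m].
Proof.
pose pi := \pi_{ideal_quot relation_ideal} : {mpoly F[n]} -> {ideal_quot relation_ideal}.
have piX j : pi 'X_j ^+ N j = 1.
  have: quot_class ('X_j ^+ N j) = quot_class 1.
    apply/quot_classP; exists (fun i => (i == j)%:R).
    rewrite (bigD1 j) //= eqxx mul1r big1 ?addr0 // => i /negPf ->.
    by rewrite mul0r.
  by rewrite /quot_class -[LHS]/(pi _) -[RHS]/(pi _) /pi rmorphXn rmorph1.
rewrite /quot_class -[LHS]/(pi _) -[RHS]/(pi _) /pi !mpolyXE_id !rmorph_prod /=.
apply: eq_bigr => j _; rewrite !rmorphXn /= mnmE.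
rewrite [in RHS](divn_eq (m j) (N j)) exprD mulnC exprM.
by rewrite -[\pi_{ideal_quot relation_ideal} 'X_j]/(pi _) piX expr1n mul1r.
Qed.

Lemma quot_class_mreduce f : quot_class (mreduce f) = quot_class f.
Proof.
pose pi := \pi_{ideal_quot relation_ideal} : {mpoly F[n]} -> {ideal_quot relation_ideal}.
rewrite [in RHS](mpolyE f) /mreduce.
rewrite /quot_class -[LHS]/(pi _) -[RHS]/(pi _) /pi !raddf_sum /=.
apply: eq_bigr => m _; rewrite -!mul_mpolyC !rmorphM /=; congr (_ * _).
exact: quot_class_monom.
Qed.

Lemma representativeP x : (forall j, (0 < N j)%N) ->
  reduced (representative x) /\ quot_class (representative x) = x.
Proof.
move=> N_gt0; apply: (@xgetPex _ 0 [set f | reduced f /\ quot_class f = x]%classic).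
exists (mreduce (repr x)); split; first exact: mreduce_reduced.
by rewrite quot_class_mreduce /quot_class reprK.
Qed.

Lemma representative_unique f g :
  reduced f -> reduced g -> quot_class f = quot_class g -> f = g.
Proof.
move=> rf rg /quot_classP /mreduce_ideal; rewrite raddfB /=.
by rewrite !mreduce_id // => /eqP; rewrite subr_eq0 => /eqP.
Qed.

End QuotientRing.

Arguments quot_var {F n N} j.

(* Main.v *)
Require Import Defs.
From HB Require Import structures.
From mathcomp Require Import all_boot all_order all_algebra.
From mathcomp Require Import generic_quotient.
From mathcomp Require Import boolp classical_sets.
From mathcomp Require Import ssrcomplements mpoly.

(* C is the tensor product of the codes C_(x_j), and the minimum distance is
   multiplicative for such product codes. A product of minimum-weight words of
   the C_(x_j), each in its own variable, gives the upper bound. Conversely,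
   fixing all exponents but the j-th in a word of C leaves a word of C_(x_j),
   since this restriction is F[x_j]-linear and kills the other relations. So
   every axis-parallel line in direction j through a point of the support meets
   the support in at least d_H(C_(x_j)) points, and induction on the directions
   bounds the size of the support. *)

Set Implicit Arguments.
Unset Strict Implicit.
Unset Printing Implicit Defensive.

Import GRing.Theory.
Local Open Scope ring_scope.

(** * Counting a finite set of exponents along axis-parallel lines *)

Section Grid.
Variables (n : nat) (S : seq 'X_{1..n}) (d : 'I_n -> nat).

(** This is the coordinate flat through [m] with directions [J]; for [J = [:: j]] it is the
    axis-parallel line in direction [j]. *)
Definition agree_off (J : seq 'I_n) (m m' : 'X_{1..n}) :=
  [forall k, (k \notin J) ==> (m' k == m k)].

Lemma agree_offP J (m m' : 'X_{1..n}) :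
  reflect (forall k, k \notin J -> m' k = m k) (agree_off J m m').
Proof.
apply: (iffP forallP) => H k; first by move=> kJ; have /implyP/(_ kJ)/eqP := H k.
by apply/implyP => /H ->.
Qed.

Hypothesis S_uniq : uniq S.
Hypothesis S_line : forall m j, m \in S -> (d j <= count (agree_off [:: j] m) S)%N.

(** Induction on [J]: the line through [m] in direction [k] has at least [d k] points in [S], and
    the flats with directions [J] through distinct points of that line are disjoint, so their counts
    add up. *)
Lemma prod_le_count_agree_off J m : uniq J -> m \in S ->
  (\prod_(j <- J) d j <= count (agree_off J m) S)%N.
Proof.
elim: J m => [|k J IH] m.
  move=> _ mS; rewrite big_nil -has_count; apply/hasP; exists m => //.
  exact/agree_offP.
case/andP => kJ uJ mS; rewrite big_cons.
pose T := [seq y <- S | agree_off [:: k] m y].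
have le_dT : (d k <= size T)%N by rewrite size_filter S_line.
apply: (@leq_trans (\sum_(y <- T) count (agree_off J y) S)).
  apply: leq_trans (leq_mul le_dT (leqnn _)) _.
  rewrite -sum1_size big_distrl /= big_seq [leqRHS]big_seq; apply: leq_sum => y.
  by rewrite mem_filter mul1n => /andP[_ yS]; apply: IH.
(* Double counting of the pairs [(y, z)]: it remains to bound, for each [z], the number of [y] in
   [T] whose flat contains [z]. *)
under eq_bigr do rewrite -sumn_count sumnE big_map.
rewrite exchange_big /= -sumn_count sumnE big_map; apply: leq_sum => z _.
have -> : \sum_(y <- T) (agree_off J y z : nat) = count (agree_off J ^~ z) T.
  by rewrite -sumn_count sumnE big_map.
(* z lies over at most one point of the line T, because k is not in J. *)
pose y0 : 'X_{1..n} := [multinom if i == k then z i else m i | i < n].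
have y0P y : y \in T -> agree_off J y z -> y = y0.
  rewrite mem_filter => /andP[/agree_offP ym _] /agree_offP zy; apply/mnmP => i.
  rewrite mnmE; case: eqP => [->|/eqP ik]; first by rewrite zy.
  by rewrite ym // inE.
have [/agree_offP zm|nzm] := boolP (agree_off (k :: J) m z).
  apply: (@leq_trans (count_mem y0 T)); last first.
    by rewrite count_uniq_mem ?leq_b1 // filter_uniq.
  rewrite (@eq_in_count _ (agree_off J ^~ z) (predI (agree_off J ^~ z) (pred1 y0))).
    by apply: sub_count => y /andP[].
  move=> y yT /=; case zy: (agree_off J y z) => //=.
  by rewrite (y0P y) ?eqxx.
rewrite leqNgt -has_count.
apply: contra nzm => /hasP[y]; rewrite mem_filter => /andP[/agree_offP ym _].
move=> /agree_offP zy; apply/agree_offP => i; rewrite inE negb_or => /andP[ik iJ].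
by rewrite zy // ym // inE.
Qed.

Lemma prod_le_size m : m \in S -> (\prod_j d j <= size S)%N.
Proof.
move=> mS; apply: leq_trans (count_size (agree_off (index_enum _) m) S).
exact/prod_le_count_agree_off/mS/index_enum_uniq.
Qed.

End Grid.

(** * Linear extension of a map on monomials *)

Section LinearExtension.
Variables (F : fieldType) (n : nat) (V : lmodType F) (phi : 'X_{1..n} -> V).

Definition lext (f : {mpoly F[n]}) : V := \sum_(m <- msupp f) f@_m *: phi m.

(** Summing over all monomials of degree below a common bound makes the index set independent of
    [f], so linearity can be checked term by term. *)
Lemma lextE k f : (msize f <= k)%N ->
  lext f = \sum_(m : 'X_{1..n < k}) f@_m *: phi m.
Proof.
move=> le_fk; pose I : subFinType _ := 'X_{1..n < k}.
rewrite /lext (big_mksub I) ?msupp_uniq //=; last first.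
  by move=> m /msize_mdeg_lt /leq_trans; apply.
by rewrite big_rmcond //= => m /memN_msupp_eq0 ->; rewrite scale0r.
Qed.

Lemma lext_linear : linear lext.
Proof.
move=> c f g; pose k := maxn (msize (c *: f + g)) (maxn (msize f) (msize g)).
rewrite !(@lextE k) ?leq_max ?leqnn ?orbT //.
rewrite scaler_sumr -big_split /=; apply: eq_bigr => m _.
by rewrite mcoeffD mcoeffZ scalerDl scalerA.
Qed.

HB.instance Definition _ :=
  GRing.isLinear.Build F {mpoly F[n]} V *:%R lext lext_linear.

Lemma lextX m : lext 'X_[m] = phi m.
Proof. by rewrite /lext msuppX big_seq1 mcoeffX eqxx scale1r. Qed.

End LinearExtension.

(** * Residue classes, weights and the minimum distance *)

Section QuotClass.
Variables (F : fieldType) (n : nat) (N : 'I_n -> nat).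
Implicit Type f : {mpoly F[n]}.

Lemma quot_class_is_zmod_morphism : zmod_morphism (@quot_class F n N).
Proof. by move=> f g; rewrite /quot_class rmorphB. Qed.

Lemma quot_class_is_monoid_morphism : monoid_morphism (@quot_class F n N).
Proof. by split=> [|f g]; rewrite /quot_class ?rmorph1 ?rmorphM. Qed.

HB.instance Definition _ := GRing.isZmodMorphism.Build
  {mpoly F[n]} (quot_ring F N) (@quot_class F n N) quot_class_is_zmod_morphism.
HB.instance Definition _ := GRing.isMonoidMorphism.Build
  {mpoly F[n]} (quot_ring F N) (@quot_class F n N) quot_class_is_monoid_morphism.

Lemma quot_class_repr (x : quot_ring F N) : quot_class N (repr x) = x.
Proof. by rewrite /quot_class reprK. Qed.

Lemma quot_class_eq0 f : reduced N f -> (quot_class N f == 0) = (f == 0).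
Proof.
move=> rf; apply/eqP/eqP => [f0|->]; last exact: rmorph0.
apply: (representative_unique rf) => [m|]; last by rewrite f0 rmorph0.
by rewrite msupp0.
Qed.

Lemma hamming_weight_reduced f : (forall j, (0 < N j)%N) -> reduced N f ->
  hamming_weight (quot_class N f) = size (msupp f).
Proof.
move=> N_gt0 rf; have [rr Er] := representativeP (quot_class N f) N_gt0.
by rewrite /hamming_weight (representative_unique rr rf Er).
Qed.

(** [HammingZero] carries the conventional value 0 of the zero code. *)
Variant hamming_distance_spec (C : set (quot_ring F N)) : nat -> Prop :=
| HammingZero of (forall x, C x -> x = 0) : hamming_distance_spec C 0%N
| HammingMin x of C x & x != 0 & (forall y, C y -> y != 0 ->
    (hamming_weight x <= hamming_weight y)%N)
    : hamming_distance_spec C (hamming_weight x).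

Lemma hamming_distanceP C : hamming_distance_spec C (hamming_distance C).
Proof.
rewrite /hamming_distance; case: pselect => [ex|nex].
  case: ex_minnP => w /asboolP[x [Cx x0] <-] min_w.
  apply: HammingMin => // y Cy y0; apply: min_w; apply/asboolP.
  by exists y.
apply: HammingZero => x Cx; apply/eqP/negP => /negP x0; apply: nex.
by exists (hamming_weight x); apply/asboolP; exists x.
Qed.

End QuotClass.

(** * Univariate polynomials placed in one of the [n] variables *)

Section Embed.
Variables (F : fieldType) (n : nat).
Implicit Types (j : 'I_n) (g : {mpoly F[1]}).

Definition embed j g : {mpoly F[n]} := g \mPo [tuple 'X_j].

Lemma embedE j g : embed j g = \sum_(m <- msupp g) g@_m *: 'X_j ^+ m ord0.
Proof.
rewrite /embed comp_mpolyE; apply: eq_bigr => m _.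
by rewrite big_ord1 (tnth_nth 0).
Qed.

(** Substituting the single variable for each of the [n] variables is a left inverse of
    [embed j]. *)
Lemma embed_eq0_inv j g : embed j g = 0 -> g = 0.
Proof.
move=> /(congr1 (comp_mpoly [tuple 'X_(ord0 : 'I_1) | _ < n])).
rewrite rmorph0 embedE raddf_sum /= => E; rewrite -[RHS]E [LHS]mpolyE.
apply: eq_bigr => m _; rewrite comp_mpolyZ rmorphXn /= comp_mpolyXU.
rewrite -tnth_nth tnth_mktuple mpolyXn; congr (_ *: 'X_[_]).
by apply/mnmP => i; rewrite mulmnE mnm1E !ord1 eqxx mul1n.
Qed.

Definition mnm_embed j (m : 'X_{1..1}) : 'X_{1..n} := (U_(j) *+ m ord0)%MM.

Lemma msupp_embed j g :
  {subset msupp (embed j g) <= [seq mnm_embed j m | m <- msupp g]}.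
Proof.
move=> m'; rewrite embedE => /msupp_sum_le /flatten_mapP[m].
rewrite filter_predT => mg /msuppZ_le.
by rewrite mpolyXn msuppX inE => /eqP->; apply: map_f.
Qed.

(** The list on the right has the product of the support sizes as its length, which gives the weight
    bound. *)
Lemma msupp_prod_le (r : seq 'I_n) (P : 'I_n -> {mpoly F[1]}) :
  {subset msupp (\prod_(j <- r) embed j (P j)) <=
    foldr (fun j ms => [seq (mnm_embed j m1 + m2)%MM | m1 <- msupp (P j), m2 <- ms])
      [:: 0%MM] r}.
Proof.
elim: r => [|j r IH] m; first by rewrite big_nil msupp1.
rewrite big_cons => /msuppM_le /allpairsP[[m1 m2] /= [m1P m2P ->]].
have /mapP[m1' m1'P ->] := msupp_embed m1P.
by apply/allpairsP; exists (m1', m2); split=> //; apply: IH.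
Qed.

Lemma size_msupp_prod (r : seq 'I_n) (P : 'I_n -> {mpoly F[1]}) :
  (size (msupp (\prod_(j <- r) embed j (P j))) <= \prod_(j <- r) size (msupp (P j)))%N.
Proof.
apply: leq_trans (uniq_leq_size (msupp_uniq _) (@msupp_prod_le r P)) _.
elim: r => [|j r IH] /=; first by rewrite big_nil.
by rewrite big_cons size_allpairs leq_mul.
Qed.

(** Only the factor of index [k] contributes to the [k]-th exponent, so the exponent bounds of the
    factors carry over to the product. *)
Lemma mcoord_msupp_prod (r : seq 'I_n) (P : 'I_n -> {mpoly F[1]}) m k :
  uniq r -> m \in msupp (\prod_(j <- r) embed j (P j)) ->
  if k \in r then exists2 m1, m1 \in msupp (P k) & m k = m1 ord0 else m k = 0%N.
Proof.
elim: r m => [|j r IH] m.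
  by rewrite big_nil msupp1 inE => _ /eqP->; rewrite mnm0E.
case/andP=> jr ur; rewrite big_cons => /msuppM_le /allpairsP[[m1 m2] /= [m1P m2P ->]].
have /mapP[m1' m1'P ->] := msupp_embed m1P; have := IH _ ur m2P.
rewrite inE mnmDE mulmnE mnm1E; case: eqVneq => [->|kj] /=.
  by rewrite (negPf jr) mul1n => ->; exists m1'; rewrite // addn0.
by rewrite mul0n add0n.
Qed.

Lemma reduced_prod_embed (N : 'I_n -> nat) (P : 'I_n -> {mpoly F[1]}) :
  (forall j, reduced (fun=> N j) (P j)) -> reduced N (\prod_j embed j (P j)).
Proof.
move=> rP m /mcoord_msupp_prod mP k; have := mP k (index_enum_uniq _).
by rewrite mem_index_enum => -[m1 /rP lt_m1 ->].
Qed.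

End Embed.

(** * Restriction of a polynomial to an axis-parallel line *)

Section Line.
Variables (F : fieldType) (n : nat) (N : 'I_n -> nat) (m0 : 'X_{1..n}) (j : 'I_n).

(* Comparing exponents modulo N makes line_poly compatible with the relations. *)
Definition on_line (m : 'X_{1..n}) :=
  [forall k, (k != j) ==> (m k == m0 k %[mod N k])].

Definition line_poly : {mpoly F[n]} -> {mpoly F[1]} :=
  lext (fun m => (on_line m)%:R *: 'X_ord0 ^+ m j).

HB.instance Definition _ := GRing.Linear.on line_poly.

Lemma line_polyX m : line_poly 'X_[m] = (on_line m)%:R *: 'X_ord0 ^+ m j.
Proof. exact: lextX. Qed.

(** Multiplying by a power of ['X_j] only moves a monomial in direction [j], so it does not affect
    [on_line]. *)
Lemma line_polyM f g : line_poly (f * embed j g) = line_poly f * g.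
Proof.
rewrite embedE [in RHS](mpolyE g) !mulr_sumr raddf_sum /=; apply: eq_bigr => c _.
rewrite -!scalerAr linearZ /=; congr (_ *: _).
have -> : 'X_[c] = 'X_ord0 ^+ c ord0 :> {mpoly F[1]}.
  rewrite mpolyXn; congr 'X_[_]; apply/mnmP => i.
  by rewrite mulmnE mnm1E !ord1 eqxx mul1n.
rewrite (mpolyE f) mulr_suml !raddf_sum /= mulr_suml; apply: eq_bigr => m _.
rewrite -scalerAl !linearZ /= -scalerAl; congr (_ *: _).
rewrite mpolyXn -mpolyXD !line_polyX -scalerAl -exprD.
rewrite mnmDE mulmnE mnm1E eqxx mul1n; congr ((nat_of_bool _)%:R *: _).
apply: eq_forallb => k; have [//|kj] := eqVneq k j.
by rewrite mnmDE mulmnE mnm1E [j == k]eq_sym (negPf kj) mul0n addn0.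
Qed.

(** Multiplying by ['X_k ^+ N k] keeps the [k]-th exponent modulo [N k] and all other exponents, so
    the two terms of the relator have the same image. *)
Lemma line_poly_relator f k : k != j -> line_poly (f * relator F N k) = 0.
Proof.
move=> kj; rewrite (mpolyE f) mulr_suml raddf_sum /= big1 // => m _.
rewrite -scalerAl linearZ /= /relator mulrBr mulr1 raddfB /= mpolyXn -mpolyXD.
rewrite !line_polyX mnmDE mulmnE mnm1E (negPf kj) mul0n addn0.
suff -> : on_line (m + U_(k) *+ N k) = on_line m by rewrite subrr scaler0.
apply: eq_forallb => i; rewrite mnmDE mulmnE mnm1E.
by case: (eqVneq k i) => [->|_]; rewrite ?mul1n ?modnDr // mul0n addn0.
Qed.

Lemma line_poly_ideal f :
  ideal_gen (relator F N) f -> ideal_gen (relator F (fun=> N j)) (line_poly f).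
Proof.
case=> a ->; exists (fun=> line_poly (a j)); rewrite big_ord1 raddf_sum /=.
(* Only the relation in ['X_j] survives, and it is the image of the univariate relation under
   [embed j]. *)
rewrite (bigD1 j) //= big1 => [|k kj]; last exact: line_poly_relator.
rewrite addr0 -line_polyM; congr (line_poly (_ * _)).
by rewrite /embed /relator rmorphB rmorph1 rmorphXn /= comp_mpolyXU.
Qed.

Lemma msupp_line_poly f : {subset msupp (line_poly f) <=
  [seq (U_(ord0) *+ (m : 'X_{1..n}) j)%MM | m <- msupp f & on_line m]}.
Proof.
move=> m1 /msupp_sum_le /flatten_mapP[m]; rewrite filter_predT => mf /msuppZ_le.
case: (boolP (on_line m)) => [lm|_]; last by rewrite scale0r msupp0.
rewrite scale1r mpolyXn msuppX inE => /eqP->.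
by apply: (map_f (fun m : 'X_{1..n} => _)); rewrite mem_filter lm.
Qed.

Variable f : {mpoly F[n]}.
Hypothesis rf : reduced N f.
Hypothesis m0f : m0 \in msupp f.

(** For exponents of a reduced polynomial, congruence modulo [N k] is equality. *)
Lemma on_lineE m : m \in msupp f -> on_line m = agree_off [:: j] m0 m.
Proof.
by move=> mf; apply: eq_forallb => k; rewrite inE !modn_small ?rf.
Qed.

Lemma reduced_line_poly : reduced (fun=> N j) (line_poly f).
Proof.
move=> m1 /msupp_line_poly /mapP[m]; rewrite mem_filter => /andP[_ mf] -> k.
by rewrite mulmnE mnm1E !ord1 eqxx mul1n rf.
Qed.

Lemma size_msupp_line_poly :
  (size (msupp (line_poly f)) <= count (agree_off [:: j] m0) (msupp f))%N.
Proof.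
apply: leq_trans (uniq_leq_size (msupp_uniq _) (@msupp_line_poly f)) _.
by rewrite size_map size_filter (eq_in_count on_lineE).
Qed.

(** The coefficient at exponent [m0 j] is that of [f] at [m0], because two points of the line with
    the same [j]-th coordinate coincide. *)
Lemma line_poly_neq0 : line_poly f != 0.
Proof.
apply/eqP => /(congr1 (mcoeff (U_(ord0) *+ m0 j))) /eqP.
rewrite mcoeff0 /line_poly /lext raddf_sum /=.
rewrite (bigD1_seq m0) ?msupp_uniq //= big_seq_cond big1 => [|m /andP[mf nm]].
  have -> : on_line m0 by apply/forallP => k; apply/implyP.
  rewrite addr0 scale1r mcoeffZ mpolyXn mcoeffX eqxx mulr1.
  by apply/negP; rewrite -mcoeff_msupp.
rewrite !mcoeffZ mpolyXn mcoeffX on_lineE //.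
case: agree_offP => [am|_]; last by rewrite mul0r mulr0.
case: eqP => [/mnmP/(_ ord0)|_]; last by rewrite !mulr0.
rewrite !mulmnE mnm1E eqxx !mul1n => Ej; case/eqP: nm; apply/mnmP => k.
by have [->//|kj] := eqVneq k j; rewrite am // inE.
Qed.

End Line.

(** * Multiplicativity of the minimum distance *)

Section ProductCode.
Variables (F : fieldType) (n : nat) (N : 'I_n -> nat).
Hypothesis N_gt0 : forall k, (0 < N k)%N.
Variable g : 'I_n -> {mpoly F[1]}.

Let Cx j : set (quot_ring F (fun _ : 'I_1 => N j)) :=
  principal_ideal (quot_class (fun=> N j) (g j)).
Let C : set (quot_ring F N) :=
  principal_ideal (quot_class N (\prod_j embed j (g j))).

Lemma principal_line m0 j f :
  C (quot_class N f) -> Cx (quot_class (fun=> N j) (line_poly N m0 j f)).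
Proof.
case=> a; rewrite -[a]quot_class_repr -rmorphM.
move/quot_classP/(line_poly_ideal m0 j); rewrite raddfB /= => /quot_classP ->.
(* The factor [embed j (g j)] leaves [line_poly] as [g j]; the other factors go into the
   multiplier. *)
rewrite (bigD1 j) //= mulrCA mulrC line_polyM rmorphM.
by eexists.
Qed.

Lemma principal_prod (P : 'I_n -> {mpoly F[1]}) :
  (forall j, @Cx j (quot_class (fun=> N j) (P j))) ->
  C (quot_class N (\prod_j embed j (P j))).
Proof.
move=> CP.
(* Membership is lifted to an identity of polynomials, which [embed j] can carry to [n]
   variables. *)
have {CP} H j : exists a b, P j = a * g j + b * relator F (fun=> N j) ord0.
  have [a] := CP j; rewrite -[a]quot_class_repr -rmorphM.
  move/quot_classP => [b]; rewrite big_ord1 => /eqP; rewrite subr_eq => /eqP ->.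
  by exists (repr a), (b ord0); rewrite addrC.
have {H} /choice[a Ha] j :
    exists a, quot_class N (embed j (P j)) = a * quot_class N (embed j (g j)).
  have [a [b ->]] := H j; exists (quot_class N (embed j a)).
  rewrite -rmorphM; apply/quot_classP.
  (* [embed j] sends the univariate relation to the one in ['X_j], so no other relation occurs. *)
  exists (fun k => if k == j then embed j b else 0).
  rewrite (bigD1 j) //= eqxx big1 ?addr0 => [|k /negPf->]; last by rewrite mul0r.
  rewrite /embed rmorphD !rmorphM addrC addKr; congr (_ * _).
  by rewrite /relator rmorphB rmorph1 rmorphXn /= comp_mpolyXU.
exists (\prod_j a j); rewrite !rmorph_prod -big_split /=.
by apply: eq_bigr => j _; rewrite -Ha.
Qed.

Lemma hamming_distance_product :
  hamming_distance C = (\prod_j hamming_distance (@Cx j))%N.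
Proof.
have Nx_gt0 j : forall k : 'I_1, (0 < N j)%N by [].
(* Besides the lower bound, a nonzero word of [C] yields nonzero words in all the [Cx j], as [upper]
   will require. *)
have lower x : C x -> x != 0 ->
    (forall j, exists2 y, @Cx j y & y != 0) /\
    (\prod_j hamming_distance (@Cx j) <= hamming_weight x)%N.
  move=> Cx0 x0; have [rf Ef] := representativeP x N_gt0.
  move: Cx0 x0; rewrite -{1 2}Ef quot_class_eq0 // => Cf f0.
  have [m0 m0f] : exists m, m \in msupp (representative x).
    case E: (msupp _) => [|m ms]; last by exists m; rewrite inE eqxx.
    by rewrite (msuppnil0 E) eqxx in f0.
  have line_nz m j : m \in msupp (representative x) ->
      quot_class (fun=> N j) (line_poly N m j (representative x)) != 0.
    by move=> mf; rewrite quot_class_eq0 ?line_poly_neq0 //; apply: reduced_line_poly.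
  split=> [j|].
    by exists (quot_class _ (line_poly N m0 j (representative x)));
      [apply: principal_line | apply: line_nz].
  apply: (@prod_le_size _ _ (fun j => hamming_distance (@Cx j)) _ _ _ m0f).
    exact: msupp_uniq.
  move=> m j mf.
  apply: leq_trans (size_msupp_line_poly j rf mf).
  rewrite -(hamming_weight_reduced (Nx_gt0 j)); last exact: reduced_line_poly.
  (* If [Cx j] is zero, its distance 0 makes the bound trivial. *)
  case: hamming_distanceP => // y _ _; apply; last exact: line_nz.
  exact: principal_line.
have upper : (forall j, exists2 y, @Cx j y & y != 0) ->
    exists x, [/\ C x, x != 0 &
      (hamming_weight x <= \prod_j hamming_distance (@Cx j))%N].
  move=> nz.
  have {nz} /choice[P HP] j : exists P : {mpoly F[1]},
      [/\ reduced (fun=> N j) P, P != 0, @Cx j (quot_class (fun=> N j) P) &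
        size (msupp P) = hamming_distance (@Cx j)].
    (* A nonzero word excludes the conventional value, so the distance is attained. *)
    case: hamming_distanceP => [C0|y Cy y0 _].
      by have [y /C0-> /eqP] := nz j.
    have [ry Ey] := representativeP y (Nx_gt0 j).
    by exists (representative y); split; rewrite ?Ey // -(quot_class_eq0 ry) Ey.
  have rP : reduced N (\prod_j embed j (P j)).
    by apply: reduced_prod_embed => j; case: (HP j).
  exists (quot_class N (\prod_j embed j (P j))); split.
  - by apply: principal_prod => j; case: (HP j).
  - rewrite quot_class_eq0 //; apply/prodf_neq0 => j _.
    by case: (HP j) => _ Pj0 _ _; apply: contra Pj0 => /eqP/embed_eq0_inv->.
  - rewrite hamming_weight_reduced //; apply: leq_trans (size_msupp_prod _ _) _.
    by apply: leq_prod => j _; case: (HP j) => _ _ _ ->.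
(* If [C] is zero, the product must vanish: positive distances would make every [Cx j] nonzero, and
   [upper] would give a nonzero word of [C]. *)
case: (hamming_distanceP C) => [C0|x Cx0 x0 min_x].
  apply/esym/eqP; rewrite -leqn0 leqNgt; apply/negP => prod_gt0.
  suff /upper[x [/C0-> /eqP]] : forall j, exists2 y, @Cx j y & y != 0 by [].
  move=> j; move: prod_gt0; rewrite (bigD1 j) //= muln_gt0 => /andP[+ _].
  by case: hamming_distanceP => // y Cy y0 _ _; exists y.
have [nz le_x] := lower x Cx0 x0.
have [y [Cy y0 le_y]] := upper nz.
by apply/eqP; rewrite eqn_leq le_x andbT (leq_trans (min_x y Cy y0)).
Qed.

End ProductCode.

(** * The codes generated by powers of the [x_j - 1] *)

Theorem theorem3p5 (p : nat) (F : finFieldType) (charF : p \in [pchar F])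
    (n : nat) (n_gt0 : (1 <= n)%N)
    (s : 'I_n -> nat) (s_gt0 : forall j, (0 < s j)%N)
    (i : 'I_n -> nat) (le_i : forall j, (i j <= p ^ s j)%N) :
  let R := quot_ring F (fun j : 'I_n => (p ^ s j)%N) in
  let Rx (j : 'I_n) := quot_ring F (fun _ : 'I_1 => (p ^ s j)%N) in
  let C : R -> Prop :=
    principal_ideal (\prod_(j < n) ((quot_var j : R) - 1) ^+ i j) in
  let Cx (j : 'I_n) : Rx j -> Prop :=
    principal_ideal (((quot_var ord0 : Rx j) - 1) ^+ i j) in
  hamming_distance C = (\prod_(j < n) hamming_distance (Cx j))%N.
Proof.
move=> R Rx C Cx.
have N_gt0 j : (0 < p ^ s j)%N by rewrite expn_gt0 prime_gt0 // (pcharf_prime charF).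
have := @hamming_distance_product F n _ N_gt0 (fun j => ('X_ord0 - 1) ^+ i j).
congr (hamming_distance (principal_ideal _) = _).
  rewrite rmorph_prod; apply: eq_bigr => j _.
  by rewrite /embed !rmorphXn !rmorphB !rmorph1 /= comp_mpolyXU.
apply: eq_bigr => j _; congr (hamming_distance (principal_ideal _)).
by rewrite rmorphXn rmorphB rmorph1.
Qed.
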